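(* For general permutations $\sigma$ of a finite set $X=\{1,\dots,n\}$, the permutation Jones polynomial $J_\sigma$ does not determine the Jones polynomial.
   Context: Diagrams are oriented link diagrams in the plane with classical crossings and possibly virtual crossings. Virtual knots and links are such diagrams up to the classical Reidemeister moves I, II, III, the purely virtual moves I, II, III, and the mixed virtual move (a strand having only virtual crossings with the others is moved past a classical crossing). $J_\sigma$ is an invariant of oriented classical and virtual knots and links; $J_\sigma(L)$ is computed from any diagram $D$ of $L$ and does not depend on the diagram chosen. Colorings. A semiarc of $D$ is an edge of the graph obtained by regarding the classical crossing points as vertices (virtual crossings are ignored; a component with no classical crossing is a single semiarc). A $\sigma$-coloring of $D$ assigns an element of $X$ to each semiarc such that at each classical crossing of sign $\epsilon\in\{+1,-1\}$: if the incoming semiarc of the under-strand has color $x$, its outgoing semiarc has color $\sigma^{\epsilon}(x)$; if the incoming semiarc of the over-strand has color $y$, its outgoing semiarc has color $\sigma^{-\epsilon}(y)$. $\mathcal{C}_\sigma(D)$ is the set of $\sigma$-colorings of $D$. Monochromatic crossings. Draw a crossing with both strands oriented upward. It is monochromatic if the two semiarcs on its left side (one incoming, one outgoing, belonging to different strands) have equal colors, and polychromatic otherwise. (For a positive crossing the left semiarcs are the incoming over-semiarc and the outgoing under-semiarc; for a negative crossing they are the incoming under-semiarc and the outgoing over-semiarc.) States. A Kauffman state $s$ of a $\sigma$-colored diagram $d$ is obtained by replacing each monochromatic crossing by one of its two smoothings and each polychromatic crossing by a virtual crossing. A positive monochromatic crossing contributes a factor $a$ for the smoothing compatible with the orientation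 and $b$ for the other smoothing; a negative monochromatic crossing contributes $a^{-1}$ for the orientation-compatible smoothing and $b^{-1}$ for the other; a polychromatic crossing of sign $\epsilon$ contributes $v^{\epsilon}$. The product of these factors is the monomial $a^xb^yv^z$ of $s$; $|s|$ is the number of closed curves in $s$ (which may cross virtually); $\mathcal S(d)$ is the set of Kauffman states of $d$. The permutation Jones polynomial is the Laurent polynomial in $a,b,v$ with integer coefficients $$J_\sigma(L)=\sum_{d\in\mathcal C_\sigma(D)}(-a^2b^{-1})^{-\mathrm{writhe}(D)}\sum_{s\in\mathcal S(d)}a^xb^yv^z(-ab^{-1}-ba^{-1})^{|s|},$$ where $\mathrm{writhe}(D)$ is the sum of the signs of the classical crossings of $D$. The Jones polynomial (in Kauffman bracket form) of $L$ is obtained from $J_{[1]}(L)$, where $[1]$ is the unique permutation of $\{1\}$, by setting $b=a^{-1}$ and dividing by $-a^2-a^{-2}$ (so that the unknot has value $1$). *)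

(* Defs.v *)
(* Mathematical Components world. *)
From mathcomp Require Import all_boot all_order all_algebra all_fingroup.
From mathcomp Require Import fraction.
From mathcomp.multinomials Require Export mpoly.

Set Implicit Arguments.
Unset Strict Implicit.
Unset Printing Implicit Defensive.

Import GRing.Theory.
Local Open Scope ring_scope.

Inductive crossing_kind := Positive | Negative | Virtual.

Definition kind_sign (k : crossing_kind) : int :=
  match k with Positive => 1 | Negative => -1 | Virtual => 0 end.

Definition is_virtual (k : crossing_kind) : bool :=
  if k is Virtual then true else false.

Notation Left := false (only parsing).
Notation Right := true (only parsing).

(* Number of classes of the equivalence relation generated by r. *)
Definition nclasses (T : finType) (r : rel T) : nat :=
  n_comp (fun x y => r x y || r y x) predT.

Section Planarity.
Variables (C E : finType) (inc out : C * bool -> E).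

Definition adjacent : rel E := fun e f =>
  [exists c, (e \in [:: inc (c, Left); inc (c, Right);
                        out (c, Left); out (c, Right)]) &&
             (f \in [:: inc (c, Left); inc (c, Right);
                        out (c, Left); out (c, Right)])].

(* A pair (e, s) is the side s of the edge e, as seen when e is traversed along
   its orientation. Two edge sides are related when they bound the same one of
   the four corners (left, right, bottom, top) of a crossing, so that the faces
   are the classes of the generated equivalence. *)
Definition corner : rel (E * bool) := fun u w =>
  [exists c,
    [|| (u == (inc (c, Left), Left)) && (w == (out (c, Left), Left)),
        (u == (inc (c, Right), Right)) && (w == (out (c, Right), Right)),
        (u == (inc (c, Left), Right)) && (w == (inc (c, Right), Left))
      | (u == (out (c, Left), Right)) && (w == (out (c, Right), Left))]].

(* Euler's formula V - E + F = 2k for the k connected components, where E = 2V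
   because crossings are 4-valent. A crossingless circle counts 0 in V, 1 in k
   and 2 in F, so the same equation accounts for it. *)
Definition euler_planar : Prop :=
  nclasses corner = (#|C| + (nclasses adjacent).*2)%N.

End Planarity.

(* A nonempty oriented link diagram in the plane, encoded by an oriented planar
   diagram code. Draw a crossing c with both strands oriented upward: inc (c, s)
   is the edge entering c at the bottom on side s, out (c, s) the edge leaving
   it at the top on side s; a strand which enters on side s leaves on side ~~ s.
   Edges run between consecutive crossings, classical or virtual; an edge which
   is not of the form inc _ is a component without any crossing. *)
Record diagram := Diagram {
  crossing : finType;
  edge : finType;
  kind : crossing -> crossing_kind;
  inc : crossing * bool -> edge;
  out : crossing * bool -> edge;
  inc_inj : injective inc;
  out_inj : injective out;
  inc_outE : codom inc =i codom out;
  planar : euler_planar inc out;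
  edge_gt0 : (0 < #|edge|)%N
}.

(* The over-strand of a positive crossing goes from bottom left to top right,
   that of a negative crossing from bottom right to top left. The values at
   virtual crossings are irrelevant. *)
Definition over_side (k : crossing_kind) : bool :=
  if k is Positive then Left else Right.
Definition under_side (k : crossing_kind) : bool := ~~ over_side k.

Section PermutationJones.
Variables (n : nat) (sigma : 'S_n) (D : diagram).
Implicit Type d : {ffun edge D -> 'I_n}.

(* A function on the semiarcs is a function on the edges which is constant
   along each strand of each virtual crossing. *)
Definition coloring_at d (c : crossing D) : bool :=
  let u := under_side (kind c) in
  let o := over_side (kind c) in
  match kind c with
  | Positive => (d (out (c, ~~ u)) == sigma (d (inc (c, u)))) &&
                (d (out (c, ~~ o)) == (sigma^-1)%g (d (inc (c, o))))
  | Negative => (d (out (c, ~~ u)) == (sigma^-1)%g (d (inc (c, u)))) &&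
                (d (out (c, ~~ o)) == sigma (d (inc (c, o))))
  | Virtual => [forall s, d (out (c, ~~ s)) == d (inc (c, s))]
  end.

Definition colorings : {set {ffun edge D -> 'I_n}} :=
  [set d | [forall c, coloring_at d c]].

Definition monochromatic d : {set crossing D} :=
  [set c | ~~ is_virtual (kind c) & d (inc (c, Left)) == d (out (c, Left))].

(* A state of the colored diagram d is encoded by the set s, contained in
   [monochromatic d], of the crossings smoothed compatibly with the
   orientation; the other monochromatic crossings get the other smoothing. *)
Definition states d : {set {set crossing D}} := powerset (monochromatic d).

(* e and f are joined at some crossing of the curves of s. *)
Definition state_link d (s : {set crossing D}) : rel (edge D) := fun e f =>
  [exists c,
    if c \notin monochromatic d then
      [exists i, (e == inc (c, i)) && (f == out (c, ~~ i))]
    else if c \in s then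
      [exists i, (e == inc (c, i)) && (f == out (c, i))]
    else
      ((e == inc (c, Left)) && (f == inc (c, Right))) ||
      ((e == out (c, Left)) && (f == out (c, Right)))].

Definition state_curves d (s : {set crossing D}) : nat :=
  nclasses (state_link d s).

Definition writhe : int := \sum_(c : crossing D) kind_sign (kind c).

Section Value.
Variables (K : fieldType) (a b v : K).

Definition state_monomial d (s : {set crossing D}) : K :=
  \prod_(c : crossing D | ~~ is_virtual (kind c))
    (if c \notin monochromatic d then v
     else if c \in s then a else b) ^ kind_sign (kind c).

(* The defining sum of J_sigma, evaluated at nonzero elements a, b, v of any
   field; the Laurent polynomial is its value at three indeterminates. *)
Definition state_sum : K :=
  \sum_(d in colorings)
    (- (a ^+ 2 * b^-1)) ^ (- writhe) *
    \sum_(s in states d)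
      state_monomial d s * (- (a * b^-1) - b * a^-1) ^+ state_curves d s.

End Value.
End PermutationJones.

(* The field Q(a, b, v), which contains the ring Z[a^+-1, b^+-1, v^+-1]. *)
Definition Qabv : fieldType := {fraction {mpoly int[3]}}.

Definition indeterminate (i : 'I_3) : Qabv := tofrac ('X_i : {mpoly int[3]}).
Definition var_a : Qabv := indeterminate (@Ordinal 3 0 isT).
Definition var_b : Qabv := indeterminate (@Ordinal 3 1 isT).
Definition var_v : Qabv := indeterminate (@Ordinal 3 2 isT).

Definition permutation_jones (n : nat) (sigma : 'S_n) (D : diagram) : Qabv :=
  state_sum sigma D var_a var_b var_v.

(* J_[1] at b = a^-1, normalized to be 1 on the unknot. *)
Definition jones (D : diagram) : Qabv :=
  state_sum (1%g : 'S_1) D var_a var_a^-1 var_v /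
  (- var_a ^+ 2 - var_a ^- 2).

(* Main.v *)
(* The classical crossing of a virtual Hopf link (one classical and one virtual
   crossing) acts by sigma^+-1 on the color of either component, so J_sigma
   vanishes on this link as soon as sigma has no fixed point. Its Jones
   polynomial is -a^-2 - a^-4 or -a^2 - a^4, according to the sign of the
   classical crossing. *)
Require Import Defs.
From mathcomp Require Import all_boot all_order all_algebra all_fingroup.
From mathcomp Require Import fraction ring.

Set Implicit Arguments.
Unset Strict Implicit.
Unset Printing Implicit Defensive.

Import GRing.Theory Num.Theory.
Local Open Scope ring_scope.

(** [f] is a complete invariant of the classes: it separates them because it is constant along
    links, and [g] picks a representative to which every point with the same value is linked. Hence
    the roots of the points [g i] list each class once. *)
Lemma nclasses_card (T I : finType) (r : rel T) (f : T -> I) (g : I -> T) :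
    cancel g f -> (forall x y, r x y -> f x = f y) ->
    (forall x, connect (fun x y => r x y || r y x) x (g (f x))) ->
  nclasses r = #|I|.
Proof.
move=> gK rf cg; rewrite /nclasses; set e := (fun x y : T => _) in cg *.
have sym_e : connect_sym e.
  by apply: sym_connect_sym => x y; rewrite /e orbC.
have ef x y : connect e x y -> f x = f y.
  case/connectP => p; elim: p x => [|z p IHp] x /= => [_ -> //|].
  by case/andP=> /orP[] /rf exz /IHp{}IHp /IHp <-.
have inj : injective (fun i => fingraph.root e (g i)).
  move=> i j /eqP; rewrite root_connect // => /ef.
  by rewrite !gK.
rewrite -(card_image inj) /n_comp_mem; apply: eq_card => x.
rewrite !inE andbT; apply/idP/imageP => [/eqP rx | [i _ ->]]; last first.
  exact: roots_root.
by exists (f x) => //; rewrite -[LHS]rx; apply/(fingraph.rootP sym_e)/cg.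
Qed.

Lemma nclasses1 (T : finType) (r : rel T) (x0 : T) :
    (forall x, connect (fun x y => r x y || r y x) x x0) ->
  nclasses r = 1%N.
Proof.
move=> cx0; rewrite -card_unit.
by apply: (nclasses_card (f := fun=> tt) (g := fun=> x0)) => // -[].
Qed.

(* The closure of the braid with a virtual crossing [false] and a crossing
   [true] on two strands; the edge (c, s) enters the crossing c on side s. *)
Section VirtualHopf.
Variable k : crossing_kind.

Definition hopf_inc (u : bool * bool) : bool * bool := u.
Definition hopf_out (u : bool * bool) : bool * bool := (~~ u.1, u.2).

Lemma hopf_inc_inj : injective hopf_inc. Proof. by []. Qed.

Lemma hopf_outK : involutive hopf_out.
Proof. by case=> c s; rewrite /hopf_out negbK. Qed.

Lemma hopf_inc_outE : codom hopf_inc =i codom hopf_out.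
Proof.
move=> u; rewrite -[u in RHS]hopf_outK codom_f.
by rewrite -[u]/(hopf_inc u) codom_f.
Qed.

Lemma hopf_planar : euler_planar hopf_inc hopf_out.
Proof.
(* All four edges meet the crossing [true], so the diagram is connected and Euler's formula asks for
   2 + 2 = 4 faces. *)
rewrite /euler_planar (nclasses1 (x0 := (true, true))); last first.
  move=> u; apply: connect1; apply/orP; left; apply/existsP; exists true.
  by case: u => [[] []].
(* The faces: [(true, s)] is the region beyond the strands on side [s] of the closed braid, and
   [(false, c)] is the bigon between the two edges entering [c]. *)
pose f (u : bool * bool * bool) :=
  if u.1.2 == u.2 then (true, u.2) else (false, u.1.1).
pose g (i : bool * bool) :=
  if i.1 then (true, i.2, i.2) else (i.2, false, true).
rewrite (nclasses_card (f := f) (g := g)) ?card_prod ?card_bool //.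
- by move=> [[] []].
- by move=> x y /existsP[[] /or4P[] /andP[/eqP-> /eqP->]].
- move=> u; suff: [|| u == g (f u), corner hopf_inc hopf_out u (g (f u))
                     | corner hopf_inc hopf_out (g (f u)) u].
    by case/orP=> [/eqP<- | ?]; [exact: connect0 | exact: connect1].
  apply/or3P; case: u => [[[] []] []]; try by [constructor 1];
    first [ by constructor 2; apply/existsP; exists true
          | by constructor 2; apply/existsP; exists false
          | by constructor 3; apply/existsP; exists true ].
Qed.

Lemma hopf_edge_gt0 : (0 < #|{: bool * bool}|)%N.
Proof. by rewrite card_prod card_bool. Qed.

Definition virtual_hopf : diagram :=
  Diagram (fun c : bool => if c then k else Virtual)
    hopf_inc_inj (inv_inj hopf_outK) hopf_inc_outE hopf_planar hopf_edge_gt0.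

Hypothesis classical_k : ~~ is_virtual k.

Lemma permutation_jones_hopf n (sigma : 'S_n) :
  (forall x, sigma x != x) -> permutation_jones sigma virtual_hopf = 0.
Proof.
move=> sigma_fpf; apply: big_pred0 => d; rewrite inE; apply/negP => /forallP dP.
have sigmaV_fpf x : (sigma^-1)%g x != x.
  by rewrite (can2_eq (permKV sigma) (permK sigma)) eq_sym.
have /forallP virt := dP false.
have /eqP eL := virt false; have /eqP eR := virt true.
move: (dP true) eL eR; rewrite /coloring_at /= /hopf_out /hopf_inc /=.
(* The under-strand enters on the right if [k] is positive, on the left if negative. The virtual
   crossing then carries its new color back to its starting edge, a fixed point of [sigma] or of its
   inverse. *)
case: k classical_k => //= _ /andP[/eqP e1 /eqP e2].
- by move=> eL _; have := sigma_fpf (d (true, true)); rewrite -e1 eL eqxx.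
- by move=> _ eR; have := sigmaV_fpf (d (true, false)); rewrite -e1 eR eqxx.
Qed.

Lemma monochromatic_hopf (d : {ffun edge virtual_hopf -> 'I_1}) :
  monochromatic d = [set true].
Proof.
apply/setP=> c; rewrite !inE (ord1 (d _)) (ord1 (d _)) eqxx andbT.
by case: c => //=; rewrite classical_k.
Qed.

(** The virtual crossing links the four edges in two pairs, and either smoothing of the classical
    crossing links an edge of one pair to an edge of the other. *)
Lemma state_curves_hopf (d : {ffun edge virtual_hopf -> 'I_1}) s :
  state_curves d s = 1%N.
Proof.
rewrite /state_curves; apply: (nclasses1 (x0 := (true, true))).
set e := (fun x y => _).
have link x y : state_link d s x y || state_link d s y x -> connect e x y.
  by move=> exy; apply: (@connect1 _ e x y exy).
have virt i : state_link d s (false, i) (true, ~~ i).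
  apply/existsP; exists false; rewrite monochromatic_hopf !inE /=.
  by apply/existsP; exists i; rewrite !eqxx.
have ff : connect e (false, false) (true, true) by apply: link; rewrite virt.
have ft : connect e (false, true) (true, false) by apply: link; rewrite virt.
have [s_true | s_true] := boolP (true \in s).
  have smooth i : state_link d s (true, i) (false, i).
    apply/existsP; exists true; rewrite monochromatic_hopf !inE /= s_true.
    by apply/existsP; exists i; rewrite !eqxx.
  have {}tf : connect e (true, false) (true, true).
    by apply: connect_trans ff; apply: link; rewrite smooth.
  by case=> [[] []] //; exact: connect_trans ft tf.
have {}tf : connect e (true, false) (true, true).
  apply: link; apply/orP; left; apply/existsP; exists true.
  by rewrite monochromatic_hopf !inE /= (negPf s_true).
by case=> [[] []] //; exact: connect_trans ft tf.
Qed.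

Lemma writhe_hopf : writhe virtual_hopf = kind_sign k.
Proof. by rewrite /writhe big_bool /= addr0. Qed.

Lemma state_sum_hopf (K : fieldType) (a b v : K) :
  state_sum (1%g : 'S_1) virtual_hopf a b v =
    (- (a ^+ 2 * b^-1)) ^ (- kind_sign k) *
    ((a ^ kind_sign k + b ^ kind_sign k) * (- (a * b^-1) - b * a^-1)).
Proof.
rewrite /state_sum writhe_hopf.
have d0 : {ffun edge virtual_hopf -> 'I_1} := [ffun=> ord0].
rewrite (big_pred1 d0); last first.
  move=> d; rewrite inE; have -> : d = d0 by apply/ffunP => e; rewrite !ord1.
  rewrite /= eqxx; apply/forallP => c; rewrite /coloring_at.
  have eq_ord1 (i j : 'I_1) : i == j by rewrite (ord1 i) (ord1 j).
  by case: kind; rewrite ?eq_ord1 //; apply/forallP.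
rewrite /states monochromatic_hopf; congr (_ * _).
(* The two states are [set0], which contributes the power of [b], and [[set true]], which
   contributes that of [a]. *)
rewrite powerset1 big_setU1 ?big_set1 /=; last first.
  by rewrite inE eq_sym -subset0 sub1set inE.
rewrite !state_curves_hopf !expr1 -mulrDl addrC; congr ((_ + _) * _).
all: rewrite /state_monomial monochromatic_hopf big_mkcond big_bool /=.
  by rewrite classical_k !inE /= mulr1.
by rewrite classical_k !inE /= mulr1.
Qed.
End VirtualHopf.

(** At [b = a^-1] the normalizing denominator is the value of one loop, nonzero since
    [a ^+ 4 != -1], and cancels. The other conditions keep the factors of the remaining difference
    nonzero. *)
Lemma normalized_hopf_neq (K : fieldType) (a v : K) :
    a != 0 -> a ^+ 4 != -1 -> a ^+ 2 != -1 -> a ^+ 6 != 1 ->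
  state_sum (1%g : 'S_1) (virtual_hopf Positive) a a^-1 v /
    (- a ^+ 2 - a ^- 2) !=
  state_sum (1%g : 'S_1) (virtual_hopf Negative) a a^-1 v /
    (- a ^+ 2 - a ^- 2).
Proof.
move=> a0; rewrite -addr_eq0 => a4; rewrite -addr_eq0 => a2.
rewrite -subr_eq0 => a6; rewrite !state_sum_hopf //= opprK !expr1z !exprN1 invrK.
rewrite -subr_eq0.
have -> : - a ^+ 2 - a ^- 2 = - ((a ^+ 4 + 1) / a ^+ 2) by field.
have -> : - (a * a) - a^-1 * a^-1 = - ((a ^+ 4 + 1) / a ^+ 2) by field.
rewrite !mulrA !mulfK ?oppr_eq0 ?mulf_neq0 ?invr_neq0 ?expf_neq0 //.
have -> : (- (a ^+ 2 * a))^-1 * (a + a^-1) - - (a ^+ 2 * a) * (a^-1 + a) =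
          (a ^+ 2 + 1) * (a ^+ 6 - 1) / a ^+ 4.
  by field; rewrite oppr_eq0 mulf_neq0 ?expf_neq0 ?a0.
by rewrite !mulf_neq0 ?invr_neq0 ?expf_neq0.
Qed.

(** An equality in the fraction field already holds between integer polynomials, where all
    indeterminates can be evaluated at 2. *)
Lemma var_a_exp_neq_int m (c : int) : 2 ^+ m != c -> var_a ^+ m != c%:~R.
Proof.
apply: contraNneq => a_m.
have: tofrac ('X_(@Ordinal 3 0 isT) ^+ m) == tofrac (c%:~R : {mpoly int[3]}).
  by rewrite rmorphXn rmorph_int; apply/eqP.
rewrite tofrac_eq => /eqP /(congr1 (meval (fun=> 2))).
by rewrite rmorphXn /= mevalXU rmorph_int intz => ->.
Qed.

Theorem proposition12 :
  exists (n : nat) (sigma : 'S_n),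
    (0 < n)%N /\
    exists D1 D2 : diagram,
      permutation_jones sigma D1 = permutation_jones sigma D2 /\
      jones D1 <> jones D2.
Proof.
(* The transposition of two points is the smallest permutation without fixed points of a nonempty
   set. *)
exists 2%N, (tperm ord0 ord_max); split=> //.
exists (virtual_hopf Positive), (virtual_hopf Negative).
have fpf x : tperm ord0 ord_max x != x :> 'I_2.
  have [->|->] : x = ord0 \/ x = ord_max; last 2 first.
  - by rewrite tpermL.
  - by rewrite tpermR.
  by case: x => [[|[|]]] // i; [left | right]; apply: val_inj.
split; first by rewrite !permutation_jones_hopf.
have a0 : var_a != 0.
  by have := @var_a_exp_neq_int 1 0 isT; rewrite expr1 mulr0z.
have aN1 m : (2 : int) ^+ m != -1 -> var_a ^+ m != -1.
  by move/var_a_exp_neq_int; rewrite mulrN1z.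
have a6 : var_a ^+ 6 != 1.
  by have := @var_a_exp_neq_int 6 1 isT; rewrite mulr1z.
move=> /eqP; rewrite /jones; apply/negP.
exact: normalized_hopf_neq a0 (aN1 4 isT) (aN1 2 isT) a6.
Qed.
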